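(* Let $G(p)=\Gamma_0+p\,\Gamma_1$ with $\Gamma_0,\Gamma_1\in\mathbb{R}^{(n+n_{\mathrm o})\times(n+n_{\mathrm i})}$ depend affinely on the scalar parameter $p$, and let $\mathbb{L},\mathbb{L}_s\in\mathbb{R}^{M(n+n_{\mathrm o})\times N(n+n_{\mathrm i})}$ be the Loewner and shifted Loewner matrices of $G$ associated with the sample points $\pi_1,\dots,\pi_M$ and $\phi_1,\dots,\phi_N$. Then $$\operatorname{rank}(\mathbb{L})=\operatorname{rank}(\Gamma_1),\qquad \operatorname{rank}(\mathbb{L}_s)\le\operatorname{rank}(\Gamma_0)+\operatorname{rank}(\Gamma_1)\operatorname{rank}(\Xi_2),$$ where $\Xi_2\in\mathbb{R}^{M(n+n_{\mathrm o})\times N(n+n_{\mathrm i})}$ is given by $$\Xi_2=\pi\otimes\mathbb{1}_{(n+n_{\mathrm o})\times N(n+n_{\mathrm i})}+\phi^T\otimes\mathbb{1}_{M(n+n_{\mathrm o})\times(n+n_{\mathrm i})},\qquad \pi=\begin{bmatrix}\pi_1&\cdots&\pi_M\end{bmatrix}^T,\ \phi=\begin{bmatrix}\phi_1&\cdots&\phi_N\end{bmatrix}^T.$$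
   Context: The sample points $\pi_1,\dots,\pi_M,\phi_1,\dots,\phi_N\in\mathbb{R}$ ($M,N\ge1$) are pairwise distinct; in particular $\pi_i\ne\phi_j$ for all $i,j$. The Loewner matrix $\mathbb{L}$ and shifted Loewner matrix $\mathbb{L}_s$ are the block matrices whose $(i,j)$-th blocks, of size $(n+n_{\mathrm o})\times(n+n_{\mathrm i})$ ($1\le i\le M$, $1\le j\le N$), are $$\{\mathbb{L}\}_{i,j}=\frac{G(\pi_i)-G(\phi_j)}{\pi_i-\phi_j},\qquad \{\mathbb{L}_s\}_{i,j}=\frac{\pi_iG(\pi_i)-\phi_jG(\phi_j)}{\pi_i-\phi_j}.$$ $\otimes$ is the Kronecker product and $\mathbb{1}_{a\times b}$ is the $a\times b$ matrix of ones. Here $n,n_{\mathrm i},n_{\mathrm o}$ are the state, input and output dimensions of an underlying parametric system. *)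

(* Defs.v *)
From mathcomp Require Import all_boot all_order all_algebra.
From mathcomp Require Import reals.
From mathcomp.real_closed Require Import mxtens.

Set Implicit Arguments.
Unset Strict Implicit.
Unset Printing Implicit Defensive.

Import GRing.Theory Num.Theory.
Local Open Scope ring_scope.

Lemma sum_const_ord (m k : nat) : (\sum_(i < m) k = m * k)%N.
Proof. by rewrite sum_nat_const card_ord. Qed.

(* [\mxblock] has dimensions given by sums of the block sizes; the cast only
   rewrites these sums as products, the shape produced by Kronecker products. *)
Definition blockmx (R : Type) (M N a b : nat)
    (B : 'I_M -> 'I_N -> 'M[R]_(a, b)) : 'M[R]_(M * a, N * b) :=
  castmx (sum_const_ord M a, sum_const_ord N b)
    (\mxblock_(i < M, j < N) B i j).

Definition loewner (R : fieldType) (M N a b : nat) (G : R -> 'M[R]_(a, b))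
    (pi : 'I_M -> R) (phi : 'I_N -> R) : 'M[R]_(M * a, N * b) :=
  blockmx (fun i j => (pi i - phi j)^-1 *: (G (pi i) - G (phi j))).

Definition shifted_loewner (R : fieldType) (M N a b : nat)
    (G : R -> 'M[R]_(a, b)) (pi : 'I_M -> R) (phi : 'I_N -> R) :
    'M[R]_(M * a, N * b) :=
  blockmx (fun i j =>
    (pi i - phi j)^-1 *: (pi i *: G (pi i) - phi j *: G (phi j))).

Definition ones (R : pzRingType) (a b : nat) : 'M[R]_(a, b) := const_mx 1.
Arguments ones {R} a b.

(* [tensmx] is the Kronecker product; the casts only identify the dimension
   [1 * k] with [k]. *)
Definition Xi2 (R : fieldType) (M N a b : nat)
    (pi : 'I_M -> R) (phi : 'I_N -> R) : 'M[R]_(M * a, N * b) :=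
  castmx (erefl, mul1n (N * b))
    (tensmx (\col_(i < M) pi i) (ones a (N * b)))
  + castmx (mul1n (M * a), erefl)
    (tensmx (\col_(j < N) phi j)^T (ones (M * a) b)).
Arguments Xi2 {R M N} a b pi phi.

(* Main.v *)
Require Import Defs.
From mathcomp Require Import all_boot all_order all_algebra.
From mathcomp Require Import reals.
From mathcomp.real_closed Require Import mxtens.

(** For affine [G] the blocks simplify: those of the Loewner matrix are all
    [Gamma1] and those of the shifted one are [Gamma0 + (pi_i + phi_j) Gamma1].
    Hence the two matrices are Kronecker products [ones (x) Gamma1] and
    [ones (x) Gamma0 + S (x) Gamma1], where [S i j = pi_i + phi_j], while
    [Xi2 = S (x) ones]; the claims follow because the rank is multiplicative on
    Kronecker products. *)

Set Implicit Arguments.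
Unset Strict Implicit.
Unset Printing Implicit Defensive.

Import GRing.Theory.
Local Open Scope ring_scope.

(** Both sides have value [i * k + j]: the rank of a block index adds the sizes of the preceding
    blocks, all equal to [k]. Block matrices and Kronecker products can thus be compared
    entrywise. *)
Lemma cast_mxtens_index (m k : nat) (i : 'I_m) (j : 'I_k) :
  cast_ord (esym (sum_const_ord m k)) (mxtens_index (i, j)) =
  tagnat.Rank (p_ := fun=> k) i j.
Proof.
apply/val_inj/(etrans _ (esym (@tagnat.RankEsum m (fun=> k) i j))).
by rewrite /= -(big_ord_widen m (fun=> k)) ?sum_const_ord // ltnW.
Qed.

Lemma blockmxE (R : Type) (M N a b : nat) (B : 'I_M -> 'I_N -> 'M[R]_(a, b))
    i k j l :
  blockmx B (mxtens_index (i, k)) (mxtens_index (j, l)) = B i j k l.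
Proof.
rewrite castmxE !cast_mxtens_index.
by have /matrixP/(_ k l) := mxblockK B i j; rewrite mxE.
Qed.

Lemma blockmx_tens (R : pzRingType) (M N a b : nat) (S : 'M[R]_(M, N))
    (A : 'M[R]_(a, b)) :
  blockmx (fun i j => S i j *: A) = tensmx S A.
Proof.
apply/matrixP=> r c; case: (mxtens_indexP r) => i k; case: (mxtens_indexP c).
by move=> j l; rewrite blockmxE tensmxE !mxE.
Qed.

Lemma blockmxD (R : nmodType) (M N a b : nat)
    (A B : 'I_M -> 'I_N -> 'M[R]_(a, b)) :
  blockmx (fun i j => A i j + B i j) = blockmx A + blockmx B.
Proof.
apply/matrixP=> r c; case: (mxtens_indexP r) => i k; case: (mxtens_indexP c).
by move=> j l; rewrite [RHS]mxE !blockmxE mxE.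
Qed.

Lemma eq_blockmx (R : Type) (M N a b : nat)
    (A B : 'I_M -> 'I_N -> 'M[R]_(a, b)) :
  (forall i j, A i j = B i j) -> blockmx A = blockmx B.
Proof. by move=> eqAB; congr castmx; apply: eq_mxblock. Qed.

Lemma tensmx1 (R : pzRingType) (m n : nat) :
  tensmx (1%:M : 'M[R]_m) (1%:M : 'M[R]_n) = 1%:M.
Proof.
apply/matrixP=> r c; case: (mxtens_indexP r) => i k; case: (mxtens_indexP c).
move=> j l; rewrite tensmxE !mxE (can_eq (@mxtens_indexK m n)) xpair_eqE.
by rewrite -natrM mulnb.
Qed.

(** Rank factorizations of [A] and [B] tensor to a factorization through dimension
    [\rank A * \rank B], whose factors still have full rank because one-sided inverses tensor to
    one-sided inverses. *)
Lemma mxrank_tens (F : fieldType) (m n p q : nat) (A : 'M[F]_(m, n))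
    (B : 'M[F]_(p, q)) :
  \rank (tensmx A B) = (\rank A * \rank B)%N.
Proof.
rewrite -{1}[A]mulmx_base -{1}[B]mulmx_base -tensmx_mul mxrankMfree.
  have /row_fullP[A' A'K] := col_base_full A.
  have /row_fullP[B' B'K] := col_base_full B.
  apply/eqP/row_fullP; exists (tensmx A' B').
  by rewrite tensmx_mul A'K B'K tensmx1.
have /row_freeP[A' A'K] := row_base_free A.
have /row_freeP[B' B'K] := row_base_free B.
by apply/row_freeP; exists (tensmx A' B'); rewrite tensmx_mul A'K B'K tensmx1.
Qed.

Lemma mxrank_ones (F : fieldType) (a b : nat) :
  (0 < a)%N -> (0 < b)%N -> \rank (ones a b : 'M[F]_(a, b)) = 1%N.
Proof.
move=> a_gt0 b_gt0; apply/eqP; rewrite eqn_leq; apply/andP; split.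
  have -> : ones a b = (ones a 1 : 'M[F]_(a, 1)) *m ones 1 b.
    by apply/matrixP=> i j; rewrite !mxE big_ord1 !mxE mulr1.
  exact: leq_trans (mxrankM_maxl _ _) (rank_leq_col _).
rewrite lt0n mxrank_eq0; apply/eqP=> /matrixP.
by move=> /(_ (Ordinal a_gt0) (Ordinal b_gt0))/eqP; rewrite !mxE oner_eq0.
Qed.

Lemma Xi2_tens (F : fieldType) (M N a b : nat) (pi : 'I_M -> F)
    (phi : 'I_N -> F) :
  Xi2 a b pi phi = tensmx (\matrix_(i < M, j < N) (pi i + phi j)) (ones a b).
Proof.
apply/matrixP=> r c; case: (mxtens_indexP r) => i k; case: (mxtens_indexP c).
move=> j l; rewrite tensmxE !mxE mulr1.
(* Each summand of [Xi2] has a Kronecker factor with a single row or column, so a cast index is read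
   as a pair with first component 0. *)
have -> : mxtens_index (j, l) =
    cast_ord (mul1n _) (mxtens_index (@ord0 0, mxtens_index (j, l))).
  exact: val_inj.
rewrite castmxE cast_ord_id cast_ordK tensmxE !mxE mulr1; congr (_ + _).
rewrite castmxE.
have -> : mxtens_index (i, k) =
    cast_ord (mul1n _) (mxtens_index (@ord0 0, mxtens_index (i, k))).
  exact: val_inj.
have -> : cast_ord (mul1n (N * b)) (mxtens_index (@ord0 0, mxtens_index (j, l)))
    = mxtens_index (j, l) by exact: val_inj.
by rewrite cast_ord_id cast_ordK tensmxE !mxE mulr1.
Qed.

Section AffineLoewner.

Variables (F : fieldType) (M N a b : nat) (pi : 'I_M -> F) (phi : 'I_N -> F).
Variables (Gamma0 Gamma1 : 'M[F]_(a, b)) (G : F -> 'M[F]_(a, b)).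
Hypothesis pi_neq_phi : forall i j, pi i <> phi j.
Hypothesis affG : forall p, G p = Gamma0 + p *: Gamma1.

Lemma sub_sample_neq0 i j : pi i - phi j != 0.
Proof. by rewrite subr_eq0; apply/eqP. Qed.

Lemma loewner_affine : loewner G pi phi = tensmx (ones M N) Gamma1.
Proof.
rewrite -blockmx_tens; apply: eq_blockmx => i j.
(* [Gamma0] cancels, leaving [(pi i - phi j) *: Gamma1]. *)
rewrite !affG opprD addrACA subrr add0r -scalerBl scalerA.
by rewrite mulVf ?sub_sample_neq0 // mxE.
Qed.

Lemma shifted_loewner_affine :
  shifted_loewner G pi phi =
  tensmx (ones M N) Gamma0 +
  tensmx (\matrix_(i < M, j < N) (pi i + phi j)) Gamma1.
Proof.
rewrite -!blockmx_tens -blockmxD; apply: eq_blockmx => i j.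
(* [Gamma0] gets the coefficient [pi i - phi j], and [Gamma1] a difference of squares, which leaves
   [pi i + phi j] after division. *)
rewrite !affG (scalerDr (pi i)) (scalerDr (phi j)) !scalerA opprD addrACA.
rewrite -!scalerBl scalerDr !scalerA -!expr2 subr_sqr mulrA.
by rewrite mulVf ?sub_sample_neq0 // mul1r !mxE.
Qed.

End AffineLoewner.

Theorem theorem4p2 (R : realType) (n ni no M N : nat)
    (hM : (1 <= M)%N) (hN : (1 <= N)%N)
    (pi : 'I_M -> R) (phi : 'I_N -> R)
    (pi_inj : injective pi) (phi_inj : injective phi)
    (pi_neq_phi : forall (i : 'I_M) (j : 'I_N), pi i <> phi j)
    (Gamma0 Gamma1 : 'M[R]_(n + no, n + ni))
    (G : R -> 'M[R]_(n + no, n + ni))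
    (hG : forall p : R, G p = Gamma0 + p *: Gamma1) :
  \rank (loewner G pi phi) = \rank Gamma1 /\
  (\rank (shifted_loewner G pi phi) <=
     \rank Gamma0 + \rank Gamma1 * \rank (Xi2 (n + no) (n + ni) pi phi))%N.
Proof.
split.
  by rewrite (loewner_affine pi_neq_phi hG) mxrank_tens mxrank_ones ?mul1n.
rewrite (shifted_loewner_affine pi_neq_phi hG) Xi2_tens.
apply: leq_trans (mxrank_add _ _) _.
(* [ones M N] has rank 1 since [M] and [N] are positive, so the [Gamma0] terms agree and cancel. *)
rewrite !mxrank_tens (@mxrank_ones _ M N) // mul1n leq_add2l.
(* [Xi2] is an empty matrix when [n + no] or [n + ni] vanishes, but then so is
   [Gamma1]. *)
have [-> | rk_gt0] := posnP (\rank Gamma1); first by rewrite muln0.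
rewrite mxrank_ones; first by rewrite muln1 mulnC.
- exact: leq_trans rk_gt0 (rank_leq_row _).
- exact: leq_trans rk_gt0 (rank_leq_col _).
Qed.
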